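(* Let $f,g:\mathbb{N}\to\mathbb{C}$ be arithmetic functions, not both identically zero, such that $f(n)=\sum_{d\mid n} g(d)$ for all $n\in\mathbb{N}$. If $\sum_{n\in \mathrm{supp}(g)} \frac{1}{n}<\infty$, then $\mathrm{supp}(f)$ possesses a positive asymptotic density. Likewise, if $\sum_{n\in \mathrm{supp}(f)} \frac{1}{n}<\infty$, then $\mathrm{supp}(g)$ possesses a positive asymptotic density.
   Context: $\mathbb{N}$ denotes the positive integers. For an arithmetic function $h$, $\mathrm{supp}(h)=\{n\in\mathbb{N}: h(n)\neq 0\}$. The asymptotic (natural) density of $\mathcal{A}\subset\mathbb{N}$ is $\lim_{x\to\infty}\frac{1}{x}\#\{n\le x: n\in\mathcal{A}\}$ when the limit exists. *)

(* Defs.v *)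
From HB Require Import structures.
From mathcomp Require Import all_boot all_order all_algebra.
From mathcomp Require Import finmap complex.
From mathcomp Require Import all_classical all_reals all_analysis.
Import Order.TTheory GRing.Theory Num.Theory.
Import numFieldNormedType.Exports.

Set Implicit Arguments.
Unset Strict Implicit.
Unset Printing Implicit Defensive.

Local Open Scope classical_set_scope.
Local Open Scope ring_scope.

(* An arithmetic function is a function on nat whose value at 0 is never used:
   every notion below restricts to the positive integers. *)

Definition supp (V : nmodType) (h : nat -> V) : set nat :=
  [set n | (0 < n)%N /\ h n <> 0].

(* The set is bounded by x, hence finite, so fset_set is not at its default
   value. *)
Definition counting_fun (R : realType) (A : set nat) (x : R) : nat :=
  #|` fset_set [set n : nat | [/\ (0 < n)%N, n%:R <= x & A n]]|.

Definition has_density (R : realType) (A : set nat) (delta : R) : Prop :=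
  x^-1 * (counting_fun A x)%:R @[x --> +oo] --> delta.

Definition has_positive_density (R : realType) (A : set nat) : Prop :=
  exists2 delta : R, 0 < delta & has_density A delta.

Definition reciprocal_sum (R : realType) (A : set nat) : \bar R :=
  \esum_(n in A) (n%:R^-1)%:E.

(* Main.v *)
Require Import Defs.
From mathcomp Require Import all_boot all_order all_algebra.
From mathcomp Require Import complex.
From mathcomp Require Import all_classical all_reals all_analysis.
From mathcomp Require Import finmap lra zify.
Import Order.TTheory GRing.Theory Num.Theory.
Import numFieldNormedType.Exports.

Local Open Scope classical_set_scope.
Local Open Scope ring_scope.

Set Implicit Arguments.
Unset Strict Implicit.
Unset Printing Implicit Defensive.

(* Outside the multiples of a set U with small reciprocal sum, membership of n
   in the support depends only on gcd(n, W) for a suitable W, so the support is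
   approximated by periodic sets and has a density. When supp g is sparse, U is
   the tail of supp g beyond T and W = T!. When supp f is sparse, U consists of
   the tail of supp f beyond T, the squares q^2 with q > T and the powers q^k with q > 1,
   and W = (T!)^k; removing from n a prime p > T only changes the sign of g n.
   For positivity, let m be the least element of the sparse support: f m = g m,
   and every n = m mod m T! that avoids U is in the other support. Among these n
   the multiples of u have density at most 1/(u T!), against 1/(m T!) for the
   whole class, so it suffices that the reciprocal sum of U be below 1/m. *)

(** * Divisor sums *)

Lemma sum_divisors_sub (V : nmodType) (h : nat -> V) (a n : nat) :
    (0 < n)%N -> (a %| n)%N ->
    (forall d : nat, (d %| n)%N -> h d <> 0 -> (d %| a)%N) ->
  \sum_(d <- divisors n) h d = \sum_(d <- divisors a) h d.
Proof.
move=> n_gt0 a_n ha; have a_gt0 := dvdn_gt0 n_gt0 a_n.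
rewrite (bigID (fun d => d %| a)%N) /= [X in _ + X]big_seq_cond.
rewrite [X in _ + X]big1 => [|d]; last first.
  rewrite -dvdn_divisors // => /andP[d_n /negP da].
  by have [//|hd] := eqVneq (h d) 0; case: da; apply: ha d_n _; apply/eqP.
rewrite addr0 -big_filter; apply/perm_big/uniq_perm.
- exact/filter_uniq/divisors_uniq.
- exact: divisors_uniq.
move=> d; rewrite mem_filter -!dvdn_divisors //.
by apply: andb_idr => /dvdn_trans; apply.
Qed.

Lemma sum_divisors_last (V : nmodType) (h : nat -> V) (n : nat) :
    (0 < n)%N -> (forall d : nat, (0 < d < n)%N -> h d = 0) ->
  \sum_(d <- divisors n) h d = h n.
Proof.
move=> n_gt0 h0; rewrite (bigD1_seq n) ?divisors_uniq -?dvdn_divisors //=.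
rewrite big_seq_cond big1 ?addr0 // => d; rewrite -dvdn_divisors // => /andP[dn dNn].
by apply: h0; rewrite (dvdn_gt0 n_gt0 dn) ltn_neqAle dNn dvdn_leq.
Qed.

Lemma divisors_prime_mul (p n : nat) :
    prime p -> (0 < n)%N -> ~~ (p %| n)%N ->
  perm_eq (divisors (p * n)) (divisors n ++ [seq (p * d)%N | d <- divisors n]).
Proof.
move=> p_pr n_gt0 pNn; have p_gt0 := prime_gt0 p_pr.
apply: uniq_perm; first exact: divisors_uniq.
  rewrite cat_uniq divisors_uniq map_inj_uniq ?divisors_uniq ?andbT /=; last first.
    by move=> d e /eqP; rewrite eqn_pmul2l // => /eqP.
  apply/hasPn => _ /mapP[d _ ->]; rewrite -dvdn_divisors //.
  by apply: contra pNn => /(dvdn_trans _); apply; exact: dvdn_mulr.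
move=> d; rewrite mem_cat -!dvdn_divisors ?muln_gt0 ?p_gt0 //.
apply/idP/orP => [dpn|[dn|/mapP[e]]].
- have [/dvdnP[e de]|pNd] := boolP (p %| d)%N.
    right; apply/mapP; exists e; last by rewrite de mulnC.
    by rewrite -dvdn_divisors // -(@dvdn_pmul2l p) // mulnC -de.
  by left; rewrite -(@Gauss_dvdr d p) // coprime_sym prime_coprime.
- exact: dvdn_mull.
- by rewrite -dvdn_divisors // => en ->; rewrite dvdn_pmul2l.
Qed.

(** The divisor sum at [d] collapses to [g d] once [g] is known to vanish below [d], so vanishing
    passes from [f] to [g] by strong induction. *)
Lemma divisor_sum_eq0 (V : zmodType) (f g : nat -> V)
    (fE : forall n : nat, (0 < n)%N -> f n = \sum_(d <- divisors n) g d)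
    (n : nat) :
    (forall d : nat, (0 < d < n)%N -> f d = 0) ->
  forall d : nat, (0 < d < n)%N -> g d = 0.
Proof.
move=> f0; elim/ltn_ind => d IHd /andP[d_gt0 dn].
rewrite -sum_divisors_last // => [|e /andP[e_gt0 ed]].
  by rewrite -fE // f0 ?d_gt0.
by rewrite IHd // e_gt0 (ltn_trans ed).
Qed.

(* Plays the role of mu(p n) = - mu(n) in the Moebius inversion of f. *)
Lemma divisor_sum_prime_mul (V : zmodType) (f g : nat -> V)
    (fE : forall n : nat, (0 < n)%N -> f n = \sum_(d <- divisors n) g d)
    (p n : nat) :
    prime p -> (0 < n)%N -> ~~ (p %| n)%N ->
    (forall d : nat, (d %| n)%N -> f (p * d)%N = 0) ->
  g (p * n)%N = - g n.
Proof.
move=> p_pr; elim/ltn_ind: n => n IHn n_gt0 pNn f0.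
have : f (p * n)%N = 0 by apply: f0.
have pn_gt0 : (0 < p * n)%N by rewrite muln_gt0 prime_gt0.
rewrite (fE _ pn_gt0) (perm_big _ (divisors_prime_mul p_pr n_gt0 pNn)) /=.
(* The sum for [p * n] groups into terms [g d + g (p * d)] with [d] dividing [n]; by induction all
   of them cancel except the one with [d = n]. *)
rewrite big_cat big_map /= -big_split /= (bigD1_seq n) ?divisors_uniq -?dvdn_divisors //=.
rewrite big_seq_cond big1 ?addr0 => [|d]; last first.
  rewrite -dvdn_divisors // => /andP[dn dNn].
  rewrite IHn ?subrr //.
  - by rewrite ltn_neqAle dNn dvdn_leq.
  - exact: dvdn_gt0 dn.
  - by apply: contra pNn => /dvdn_trans; apply.
  - by move=> e ed; apply/f0/(dvdn_trans ed).
by move=> /eqP; rewrite addrC addr_eq0 => /eqP.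
Qed.

(** The prime factors of [b] are stripped off one at a time: each occurs only once in [a * b], and
    [f] vanishes at every divisor of [a * b] containing it, so removing it only flips the sign of
    [g]. *)
Lemma divisor_sum_neq0 (V : zmodType) (f g : nat -> V)
    (fE : forall n : nat, (0 < n)%N -> f n = \sum_(d <- divisors n) g d)
    (a b : nat) :
    (0 < a)%N -> (0 < b)%N ->
    (forall p : nat, prime p -> (p %| b)%N -> ~~ (p ^ 2 %| a * b)%N) ->
    (forall d : nat, (d %| a * b)%N -> f d <> 0 -> (d %| a)%N) ->
  (g (a * b)%N == 0) = (g a == 0).
Proof.
move=> a_gt0; elim/ltn_ind: b => b IHb b_gt0 sqf_b f_a.
have [->|b_neq1] := eqVneq b 1%N; first by rewrite muln1.
have [p p_pr /dvdnP[c bE]] : exists2 p, prime p & (p %| b)%N.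
  by exists (pdiv b); rewrite ?pdiv_prime ?pdiv_dvd // ltn_neqAle eq_sym b_neq1.
have p_gt1 := prime_gt1 p_pr.
have c_gt0 : (0 < c)%N by move: b_gt0; rewrite bE muln_gt0 => /andP[].
have abE : (a * b = p * (a * c))%N by rewrite bE mulnA mulnC.
have pNac : ~~ (p %| a * c)%N.
  have := sqf_b p p_pr; rewrite bE dvdn_mull // => /(_ isT); apply: contra.
  by move=> pac; rewrite mulnA mulnC expnS expn1 dvdn_pmul2l // ltnW.
rewrite abE (divisor_sum_prime_mul fE) ?muln_gt0 ?a_gt0 //; last first.
  move=> d dac; apply: contraNeq pNac => /eqP fpd; apply: dvdn_mulr.
  apply: dvdn_trans (dvdn_mulr d (dvdnn p)) (f_a _ _ fpd).
  by rewrite abE dvdn_pmul2l // ltnW.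
rewrite oppr_eq0 IHb //.
- by rewrite bE -[X in (X < _)%N]muln1 ltn_pmul2l.
- move=> q q_pr qc; apply: contra (sqf_b q q_pr _); last by rewrite bE dvdn_mulr.
  by rewrite abE; exact: dvdn_mull.
- by move=> d dac; apply: f_a; rewrite abE dvdn_mull.
Qed.

(** * Values determined by a gcd or by a residue class *)

Lemma dvdn_fact_eqmod (m T n d : nat) :
  n = m %[mod m * T`!] -> (0 < d <= T)%N -> (d %| n)%N = (d %| m)%N.
Proof.
move=> nm dT; have dM : (d %| m * T`!)%N by rewrite dvdn_mull ?dvdn_fact.
by rewrite /dvdn -(modn_dvdm n dM) nm modn_dvdm.
Qed.

Lemma eqmod_dvdn (m P n : nat) : n = m %[mod m * P] -> (m %| n)%N.
Proof.
have mM : (m %| m * P)%N by exact: dvdn_mulr.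
by move=> nm; rewrite /dvdn -(modn_dvdm n mM) nm modn_dvdm // modnn.
Qed.

(** The divisors of [n] at which [g] is nonzero are at most [T], so they divide [T!] and hence the
    gcd. *)
Lemma divisor_sum_gcd (V : zmodType) (f g : nat -> V)
    (fE : forall n : nat, (0 < n)%N -> f n = \sum_(d <- divisors n) g d)
    (T n : nat) :
    (0 < n)%N -> (forall d : nat, (T < d)%N -> g d <> 0 -> ~ (d %| n)%N) ->
  f n = f (gcdn n T`!).
Proof.
move=> n_gt0 gT; rewrite !fE ?gcdn_gt0 ?n_gt0 //.
apply: sum_divisors_sub => // [|d dn gd]; first exact: dvdn_gcdl.
rewrite dvdn_gcd dn dvdn_fact // (dvdn_gt0 n_gt0 dn) leqNgt.
by apply/negP => /gT/(_ gd).
Qed.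

(** Only divisors up to [T] matter, and the congruence gives [n] and [m] the same divisors in that
    range. *)
Lemma divisor_sum_eqmod (V : zmodType) (f g : nat -> V)
    (fE : forall n : nat, (0 < n)%N -> f n = \sum_(d <- divisors n) g d)
    (m T n : nat) :
    (0 < m)%N -> (0 < n)%N -> n = m %[mod m * T`!] ->
    (forall d : nat, (T < d)%N -> g d <> 0 -> ~ (d %| n)%N) ->
  f n = f m.
Proof.
move=> m_gt0 n_gt0 nm gT; rewrite !fE //.
apply: sum_divisors_sub => // [|d dn gd]; first exact: eqmod_dvdn nm.
rewrite -(dvdn_fact_eqmod nm) // (dvdn_gt0 n_gt0 dn) leqNgt.
by apply/negP => /gT/(_ gd).
Qed.

(** Write [n = a * b] with [a] the gcd. Primes above [T] divide [n] at most once, and the exponent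
    [k.+1] is large enough to keep primes up to [T] out of [b], so [divisor_sum_neq0] applies. *)
Lemma divisor_sum_inv_gcd (V : zmodType) (f g : nat -> V)
    (fE : forall n : nat, (0 < n)%N -> f n = \sum_(d <- divisors n) g d)
    (T k n : nat) :
    (0 < n)%N -> (forall d : nat, (T < d)%N -> f d <> 0 -> ~ (d %| n)%N) ->
    (forall q : nat, (T < q)%N -> ~ (q ^ 2 %| n)%N) ->
    (forall q : nat, (1 < q)%N -> ~ (q ^ k.+1 %| n)%N) ->
  (g n == 0) = (g (gcdn n (T`! ^ k.+1)) == 0).
Proof.
move=> n_gt0 fT sqT powN; set W := (_ ^ _)%N; set a := gcdn n W.
have a_gt0 : (0 < a)%N by rewrite gcdn_gt0 n_gt0.
have [b nE] : exists b, n = (a * b)%N.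
  by exists (n %/ a)%N; rewrite mulnC divnK ?dvdn_gcdl.
have [c WE] : exists c, W = (a * c)%N.
  by exists (W %/ a)%N; rewrite mulnC divnK ?dvdn_gcdr.
have bc1 : coprime b c.
  by rewrite /coprime -(eqn_pmul2l a_gt0) muln_gcdr -nE -WE muln1.
have b_gt0 : (0 < b)%N by move: n_gt0; rewrite {1}nE muln_gt0 => /andP[].
rewrite [in LHS]nE; apply: (divisor_sum_neq0 fE) => // [p p_pr pb|d]; rewrite -nE.
  apply/negP => ppn; have [pT|/sqT//] := leqP p T.
  (* As [p] divides [b], it is coprime to [c]; hence the power of [p] dividing [W = a * c] divides
     [a], and so [n], against the last hypothesis. *)
  have pW : (p ^ k.+1 %| W)%N by rewrite dvdn_exp2r // dvdn_fact // prime_gt0.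
  apply: (powN p (prime_gt1 p_pr)); apply: dvdn_trans (dvdn_gcdl n W).
  rewrite -(@Gauss_dvdl _ a c) -?WE //.
  by apply: coprimeXl; exact: coprime_dvdl pb bc1.
move=> dn fd; rewrite dvdn_gcd dn /W expnS dvdn_mulr // dvdn_fact //.
by rewrite (dvdn_gt0 n_gt0 dn) leqNgt; apply/negP => /fT/(_ fd).
Qed.

(** Here [n = m * b] with [b] congruent to 1 modulo [T!], so no prime up to [T] divides [b], while a
    larger prime cannot divide [n] twice. *)
Lemma divisor_sum_inv_eqmod (V : zmodType) (f g : nat -> V)
    (fE : forall n : nat, (0 < n)%N -> f n = \sum_(d <- divisors n) g d)
    (m T n : nat) :
    (0 < m)%N -> (0 < n)%N -> n = m %[mod m * T`!] ->
    (forall d : nat, (T < d)%N -> f d <> 0 -> ~ (d %| n)%N) ->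
    (forall q : nat, (T < q)%N -> ~ (q ^ 2 %| n)%N) ->
  (g n == 0) = (g m == 0).
Proof.
move=> m_gt0 n_gt0 nm fT sqT.
have [b nE] : exists b, n = (m * b)%N.
  by exists (n %/ m)%N; rewrite mulnC divnK ?(eqmod_dvdn nm).
have b_gt0 : (0 < b)%N by move: n_gt0; rewrite nE muln_gt0 => /andP[].
rewrite nE; apply: (divisor_sum_neq0 fE) => // [p p_pr pb|d]; rewrite -nE.
  apply/negP => ppn; have [pT|/sqT//] := leqP p T.
  move: nm; rewrite nE -{3}[m]muln1 -!muln_modr => /eqP.
  rewrite eqn_pmul2l // => /eqP b1.
  have pT' : (p %| T`!)%N by rewrite dvdn_fact // prime_gt0.
  move: pb; rewrite /dvdn -(modn_dvdm b pT') b1 modn_dvdm //.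
  by rewrite modn_small // prime_gt1.
move=> dn fd; rewrite -(dvdn_fact_eqmod nm) //.
by rewrite (dvdn_gt0 n_gt0 dn) leqNgt; apply/negP => /fT/(_ fd).
Qed.

(** * Counting functions and densities *)

Definition cnt (A : set nat) (N : nat) : nat := \sum_(1 <= n < N.+1) `[< A n >].

Definition multiples (U : set nat) : set nat :=
  [set n | exists2 u, U u & (u %| n)%N].

(** Convergence is expressed by finite sums only; they start at 1, so an element 0 of [U]
    contributes nothing. *)
Definition recip_le (R : realType) (U : set nat) (c : R) : Prop :=
  forall N : nat, \sum_(1 <= u < N.+1 | `[< U u >]) u%:R^-1 <= c.

(** A finitary bound forcing the upper limit of [|cnt A N / N - beta|] to be at most [eps]. The
    constant [C] absorbs bounded errors, so that approximations combine by linear arithmetic. *)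
Definition frequency_near (R : realType) (A : set nat) (beta eps : R) : Prop :=
  exists C : R, forall N : nat,
    `|(cnt A N)%:R - beta * N%:R| <= eps * N%:R + C.

Lemma counting_funE (R : realType) (A : set nat) (x : R) :
  0 <= x -> counting_fun A x = cnt A (Num.truncn x).
Proof.
move=> x_ge0; rewrite /counting_fun /cnt.
set N := Num.truncn x; set B := [set n | _].
have -> : B = [set` [seq n <- index_iota 1 N.+1 | `[< A n >]]].
  apply/seteqP; split => n /=; rewrite mem_filter mem_index_iota ltnS.
    by move=> [n_gt0 nx An]; rewrite n_gt0 truncn_ge_nat // nx /= andbT; apply/asboolP.
  by rewrite truncn_ge_nat // => /andP[/asboolP An /andP[]].
rewrite (_ : fset_set _ = [fset n in [seq n <- index_iota 1 N.+1 | `[< A n >]]]%fset).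
  rewrite card_fseq undup_id ?filter_uniq ?iota_uniq //.
  rewrite size_filter -sum1_count big_mkcond /=.
  by apply: eq_bigr => n _; case: `[< A n >].
apply/fsetP => n; rewrite in_fset_set; last exact: finite_seq.
by rewrite mem_setE inE.
Qed.

Lemma cnt_leD (A B E : set nat) (N : nat) :
    (forall n : nat, (0 < n)%N -> A n -> B n \/ E n) ->
  (cnt A N <= cnt B N + cnt E N)%N.
Proof.
move=> ABE; rewrite /cnt -big_split /= !big_nat; apply: leq_sum => n /andP[n_gt0 _].
case: asboolP => // An; case: (ABE n n_gt0 An) => h.
  by rewrite (asboolT h).
by rewrite (asboolT h) leq_addl.
Qed.

Lemma cnt_le_id (A : set nat) (N : nat) : (cnt A N <= N)%N.
Proof.
rewrite /cnt -[leqRHS]subn0 -subSS -[leqRHS]muln1 -sum_nat_const_nat.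
by apply: leq_sum => n _; exact: leq_b1.
Qed.

(** Lets [N] tend to infinity in an inequality between linear functions of [N]: the slopes compare,
    whatever the constants. *)
Lemma archi_le0 (R : realType) (a C : R) :
  (forall N : nat, a * N%:R <= C) -> a <= 0.
Proof.
move=> aC; rewrite leNgt; apply/negP => a_gt0.
have := aC (Num.truncn (C / a)).+1; apply/negP; rewrite -ltNge mulrC -ltr_pdivrMr //.
exact: truncnS_gt.
Qed.

Lemma has_density_frequency (R : realType) (A : set nat) (delta : R) :
  (forall eps : R, 0 < eps -> frequency_near A delta eps) -> has_density A delta.
Proof.
move=> near_delta; apply/cvgrPdist_lt => eps eps_gt0.
have eps3_gt0 : 0 < eps / 3 by rewrite divr_gt0.
have [C hC] := near_delta _ eps3_gt0.
near=> x.
have x_gt0 : 0 < x by near: x; exact: nbhs_pinfty_gt.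
(* Replacing [x] by its integer part costs at most [|delta|]. From this threshold on, that cost and
   [C] together take at most [eps / 3 * x], which leaves a total of at most two thirds of
   [eps * x]. *)
have xC : (`|delta| + C) / (eps / 3) <= x.
  by near: x; apply: nbhs_pinfty_ge; exact: num_real.
rewrite counting_funE ?ltW //; set N := Num.truncn x.
have /andP[Nx xN] := truncn_itv (ltW x_gt0).
rewrite -[X in `|X|](mulKf (lt0r_neq0 x_gt0)) normrM normfV (gtr0_norm x_gt0).
rewrite ltr_pdivrMl // mulrBr mulVKf ?lt0r_neq0 //.
rewrite (_ : _ - _ = delta * (x - N%:R) - ((cnt A N)%:R - delta * N%:R)); last lra.
apply: le_lt_trans (ler_normB _ _) _; rewrite normrM.
have : `|delta| * `|x - N%:R| <= `|delta| * 1.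
  apply: ler_wpM2l => //; rewrite ger0_norm ?subr_ge0 // lerBlDl.
  by rewrite -natr1 in xN; exact: ltW.
have := hC N; move: xC; rewrite ler_pdivrMr //.
have : eps / 3 * N%:R <= eps / 3 * x by rewrite ler_pM2l.
set p := `|delta| * _; set q := `|_ - _|; nra.
Unshelve. all: by end_near. Qed.

(** A Cauchy criterion: each left end [b - e] lies below each right end [b' + e'], so the supremum
    of the left ends belongs to all these intervals and is the density. *)
Lemma frequency_near_density (R : realType) (A : set nat) :
    (forall eps : R, 0 < eps -> exists beta : R, frequency_near A beta eps) ->
  exists delta : R, forall eps : R, 0 < eps -> frequency_near A delta eps.
Proof.
move=> nearA.
have close b1 e1 b2 e2 : frequency_near A b1 e1 -> frequency_near A b2 e2 ->
    b1 - e1 <= b2 + e2.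
  move=> [C1 h1] [C2 h2]; rewrite -subr_le0; apply: (@archi_le0 _ _ (C1 + C2)) => N.
  have := h1 N; have := h2 N; rewrite !ler_norml => /andP[? ?] /andP[? ?].
  lra.
pose E : set R := [set r | exists b e, frequency_near A b e /\ r = b - e].
have ubE b e : frequency_near A b e -> ubound E (b + e).
  by move=> be _ [b' [e' [be' ->]]]; exact: close be' be.
exists (sup E) => eps eps_gt0; have eps2_gt0 : 0 < eps / 2 by rewrite divr_gt0.
have [b be] := nearA _ eps2_gt0.
have Ebe : E (b - eps / 2) by exists b, (eps / 2).
have supE : b - eps / 2 <= sup E <= b + eps / 2.
  rewrite ub_le_sup //=; last by exists (b + eps / 2); exact: ubE.
  by apply: ge_sup; [exists (b - eps / 2)|exact: ubE].
have [C hC] := be; exists C => N; have := hC N.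
rewrite !ler_norml => /andP[? ?].
have := ler0n R N; move: supE; set s := sup E; set n := N%:R; nra.
Qed.

Lemma cnt_periodic (A : set nat) (W : nat) :
    (forall n : nat, (0 < n)%N -> A (W + n)%N <-> A n) ->
  forall q r : nat, cnt A (q * W + r) = (q * cnt A W + cnt A r)%N.
Proof.
move=> AW.
have step n : cnt A (W + n) = (cnt A W + cnt A n)%N.
  rewrite /cnt (@big_cat_nat _ _ _ W.+1) ?ltnS ?leq_addr //=; congr addn.
  rewrite -[W.+1]add1n big_addn -addnS addKn big_nat [RHS]big_nat.
  apply: eq_bigr => i /andP[i_gt0 _]; congr nat_of_bool.
  by rewrite addnC; apply/asbool_equiv_eq/AW.
elim=> [|q IHq] r; first by rewrite !mul0n.
by rewrite mulSn -addnA step IHq mulSn addnA.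
Qed.

(** Complete periods contribute exactly; the error comes from the last, incomplete one and is at
    most its length. *)
Lemma periodic_frequency (R : realType) (A : set nat) (W : nat) :
    (0 < W)%N -> (forall n : nat, (0 < n)%N -> A (W + n)%N <-> A n) ->
  forall N : nat, `|(cnt A N)%:R - (cnt A W)%:R / W%:R * N%:R| <= W%:R :> R.
Proof.
move=> W_gt0 AW N; rewrite (divn_eq N W) cnt_periodic //.
have rW : (N %% W < W)%N by rewrite ltn_mod.
have W_gt0' : 0 < W%:R :> R by rewrite ltr0n.
set r := (N %% W)%N in rW *; set q := (N %/ W)%N; rewrite !natrD !natrM.
have -> : (cnt A W)%:R / W%:R * (q%:R * W%:R + r%:R) =
    q%:R * (cnt A W)%:R + (cnt A W)%:R / W%:R * r%:R :> R.
  by rewrite mulrDr; congr (_ + _); rewrite mulrCA divfK // gt_eqF.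
rewrite opprD addrACA subrr add0r ler_norml.
have b1 : (cnt A W)%:R / W%:R <= 1 :> R.
  by rewrite ler_pdivrMr // mul1r ler_nat cnt_le_id.
have b0 : 0 <= (cnt A W)%:R / W%:R :> R by rewrite divr_ge0.
have cr : (cnt A r)%:R <= r%:R :> R by rewrite ler_nat cnt_le_id.
have rW' : r%:R < W%:R :> R by rewrite ltr_nat.
have := ler0n R r; have := ler0n R (cnt A r).
set b := _ / _ in b1 b0 *; move: b1 b0 cr rW' W_gt0'; set x := r%:R; nra.
Qed.

(** * Bounds on reciprocal sums *)

Lemma recip_leU (R : realType) (U V : set nat) (c d : R) :
  recip_le U c -> recip_le V d -> recip_le (U `|` V) (c + d).
Proof.
move=> Uc Vd N; apply: le_trans (lerD (Uc N) (Vd N)).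
rewrite [X in _ <= X + _]big_mkcond [X in _ <= _ + X]big_mkcond -big_split big_mkcond /=.
apply: ler_sum => u _.
have u0 : 0 <= u%:R^-1 :> R by rewrite invr_ge0.
by do 3?case: asboolP => //=; rewrite ?addr_ge0 ?lerDl ?lerDr ?addr0 //; move=> nV nU [].
Qed.

(** [T] is chosen so that the partial sum up to [T] is within [eps] of the supremum of all partial
    sums; the terms beyond any [t >= T] add up to at most this gap. *)
Lemma recip_le_tail (R : realType) (U : set nat) (c eps : R) :
    recip_le U c -> 0 < eps ->
  exists T : nat, forall t : nat, (T <= t)%N ->
    recip_le (U `&` [set u | (t < u)%N]) eps.
Proof.
move=> Uc eps_gt0; pose s N : R := \sum_(1 <= u < N.+1 | `[< U u >]) u%:R^-1.
have sD M N : (M <= N)%N ->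
    s N = s M + \sum_(M.+1 <= u < N.+1 | `[< U u >]) u%:R^-1.
  by move=> MN; rewrite /s (@big_cat_nat _ _ _ M.+1).
have s_mono M N : (M <= N)%N -> s M <= s N.
  by move=> MN; rewrite (sD M N) // lerDl sumr_ge0.
have supE : has_sup (range s).
  split; first by exists (s 0%N), 0%N.
  by exists c => _ [N _ <-]; exact: Uc.
have [_ [T _ <-] Ts] := sup_adherent eps_gt0 supE.
exists T => t Tt N; have [Nt|tN] := leqP N t.
  rewrite big_nat_cond big1 ?ltW // => u /andP[/andP[_ uN] /asboolP[_ /=]].
  by rewrite ltnNge (leq_trans _ Nt).
have -> : \sum_(1 <= u < N.+1 | `[< (U `&` [set u | (t < u)%N]) u >]) u%:R^-1 =
    s N - s t.
  rewrite (sD t N) 1?ltnW // addrC addKr (@big_cat_nat _ _ _ t.+1) //=; last exact: ltnW.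
  rewrite big_nat_cond big1 ?add0r => [|u /andP[/andP[_ ut] /asboolP[_ /=]]]; last first.
    by rewrite ltnNge -ltnS ut.
  rewrite big_nat_cond [RHS]big_nat_cond; apply: eq_bigl => u.
  case: (boolP (t < u < N.+1)%N) => //= /andP[tu _]; apply/asbool_equiv_eq.
  by split => [[]//|Uu]; split.
have := ub_le_sup supE.2 (imageT s N); have := s_mono _ _ Tt; lra.
Qed.

(** Telescoping: [(k + 1) * (q - 1) * q <= q ^ (k + 2)], since [k + 1 <= 2 ^ k <= q ^ k]. The bound
    is small for large [T], which serves for squares, and for [T = 1] with large [k], which serves
    for high powers. *)
Lemma recip_le_pow (R : realType) (T k : nat) : (0 < T)%N ->
  recip_le [set u | exists2 q, (T < q)%N & u = (q ^ k.+2)%N]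
           ((k.+1 * T)%:R^-1 : R).
Proof.
move=> T_gt0 N; set U := [set u | _].
pose F q : R := (q ^ k.+2)%:R^-1.
have Fle q : (T < q)%N -> F q <= k.+1%:R^-1 * (q.-1%:R^-1 - q%:R^-1).
  case: q => // q; rewrite ltnS succnK => Tq; have q_gt0 := leq_trans T_gt0 Tq.
  have -> : q%:R^-1 - q.+1%:R^-1 = (q * q.+1)%:R^-1 :> R.
    have q0 : q%:R != 0 :> R by rewrite pnatr_eq0 -lt0n.
    rewrite natrM; apply: (mulfI (mulf_neq0 q0 (lt0r_neq0 (ltr0Sn R q)))).
    rewrite divff ?mulf_neq0 ?pnatr_eq0 -?lt0n // mulrBr mulrAC divff // mul1r.
    by rewrite mulfK ?pnatr_eq0 // -natrB // subSnn.
  rewrite -invfM -natrM /F lef_pV2 ?posrE ?ltr0n ?expn_gt0 ?muln_gt0 ?q_gt0 //.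
  rewrite ler_nat.
  rewrite -addn2 expnD leq_mul //; last by rewrite expnS expn1 leq_mul.
  by apply: leq_trans (ltn_expl k (ltnSn 1)) _; case: (k) => // j; rewrite leq_exp2r.
have leF : \sum_(1 <= u < N.+1 | `[< U u >]) u%:R^-1 <= \sum_(T.+1 <= q < (T + N).+1) F q.
  (* Double counting: each [u] in [U] up to [N] is a power of some [r <= u], so [r] is in the range
     of [q], and each [q] accounts for at most one [u]. The range [T < q <= T + N] is empty for
     [N = 0], where the telescoping induction starts. *)
  pose G u q : R := if u == (q ^ k.+2)%N then F q else 0.
  apply: (@le_trans _ _ (\sum_(1 <= u < N.+1) \sum_(T.+1 <= q < (T + N).+1) G u q)).
    rewrite big_mkcond !big_nat; apply: ler_sum => u /andP[u_gt0 uN].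
    have G_ge0 v : 0 <= G u v by rewrite /G /F; case: ifP.
    case: asboolP => [[r Tr uE]|_]; last by apply: sumr_ge0.
    rewrite (bigD1_seq r) ?iota_uniq ?mem_index_iota ?Tr //=; last first.
      have : (r <= u)%N by rewrite uE -[leqLHS]expn1 leq_exp2l // (leq_ltn_trans T_gt0).
      by move: uN; lia.
    have -> : G u r = u%:R^-1 by rewrite /G /F -uE eqxx.
    by rewrite lerDl sumr_ge0.
  rewrite exchange_big /=; apply: ler_sum => q _.
  rewrite -big_mkcond /= big_const_seq.
  have : (count (fun u => u == (q ^ k.+2)%N) (index_iota 1 N.+1) <= 1)%N.
    by rewrite (@count_uniq_mem _ _ (q ^ k.+2)%N) ?iota_uniq // leq_b1.
  by case: count => [|[|//]] _ /=; rewrite ?addr0 // /F invr_ge0.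
apply: (le_trans leF).
apply: (@le_trans _ _ (k.+1%:R^-1 * (T%:R^-1 - (T + N)%:R^-1))); last first.
  by rewrite natrM invfM ler_pM2l ?invr_gt0 // gerBl invr_ge0.
elim: {leF} N => [|N IHN]; first by rewrite addn0 subrr mulr0 big_geq.
rewrite addnS big_nat_recr ?ltnS ?leq_addr //=.
have := lerD IHN (Fle (T + N).+1 _); rewrite ltnS leq_addr => /(_ isT).
move=> /le_trans; apply; rewrite -mulrDr /= addrA subrK //.
Qed.

(** * Multiples of a set with convergent reciprocal sum *)

Lemma reciprocal_sum_recip_le (R : realType) (A : set nat) :
  (reciprocal_sum R A < +oo)%E -> exists c : R, recip_le A c.
Proof.
rewrite /reciprocal_sum.
have AE : A = [set n | `[< A n >]] by apply/seteqP; split => n /= /asboolP.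
have inv_ge0 n : `[< A n >] -> (0 <= (n%:R^-1)%:E :> \bar R)%E.
  by rewrite lee_fin invr_ge0.
rewrite [X in esum X]AE -nneseries_esum //; set s := (X in (X < _)%E) => s_fin.
exists (fine s) => N; rewrite -lee_fin -sumEFin.
rewrite fineK; last first.
  by rewrite ge0_fin_numE //; apply: nneseries_ge0 => n _ /inv_ge0.
apply: le_trans (nneseries_lim_ge N.+1 _); last by move=> n _ /inv_ge0.
(* The series starts at index 0; its first term is nonnegative and is dropped. *)
rewrite [leRHS]big_ltn_cond //; case: ifPn => [/inv_ge0 h|_]; rewrite ?leeDr //.
Qed.

(** Elements at least [M] apart lie in different blocks of length [M], so [n %/ M] is injective on
    [A]. *)
Lemma cnt_gap (A : set nat) (M N : nat) : (0 < M)%N ->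
    (forall n n' : nat, A n -> A n' -> (n < n')%N -> (n + M <= n')%N) ->
  (cnt A N <= (N %/ M).+1)%N.
Proof.
move=> M_gt0 gapA; pose s := [seq n <- index_iota 1 N.+1 | `[< A n >]].
have -> : cnt A N = size [seq (n %/ M)%N | n <- s].
  rewrite size_map size_filter -sum1_count big_mkcond /=.
  by apply: eq_bigr => n _; case: asboolP.
rewrite -[leqRHS](size_iota 0); apply: uniq_leq_size; last first.
  move=> k /mapP[n]; rewrite mem_filter mem_index_iota ltnS => /and3P[_ _ nN] ->.
  by rewrite mem_iota /= add0n ltnS leq_div2r.
rewrite map_inj_in_uniq ?filter_uniq ?iota_uniq // => n n'.
rewrite !mem_filter => /andP[/asboolP An _] /andP[/asboolP An' _] nn'.
have divM k k' : A k -> A k' -> (k < k')%N -> (k %/ M < k' %/ M)%N.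
  move=> Ak Ak' /(gapA _ _ Ak Ak')/(leq_div2r M).
  by rewrite divnDr ?divnn ?M_gt0 ?addn1.
by case: (ltngtP n n') => // /divM => [/(_ An An')|/(_ An' An)]; rewrite nn' ltnn.
Qed.

Lemma cnt_dvdn_eqmod (u m P N : nat) : (0 < u)%N -> (0 < m)%N -> (0 < P)%N ->
  (cnt [set n | n = m %[mod m * P] /\ (u %| n)%N] N <= (N %/ (u * P)).+1)%N.
Proof.
move=> u_gt0 m_gt0 P_gt0; set A := [set n | _].
apply: cnt_gap; first by rewrite muln_gt0 u_gt0.
(* A lies in one residue class modulo lcm(u, m P), and gcd(u, m P) divides m as
   soon as A is nonempty, so that lcm(u, m P) >= u P. *)
move=> n n' [nm un] [n'm un'] nn'; rewrite -leq_subRL ?(ltnW nn') //.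
have L : (lcmn u (m * P) %| n' - n)%N.
  by rewrite dvdn_lcm dvdn_sub // -eqn_mod_dvd ?(ltnW nn') // n'm nm eqxx.
have g_m : (gcdn u (m * P) %| m)%N.
  have gn := dvdn_trans (dvdn_gcdl u (m * P)) un.
  by move: gn; rewrite /dvdn -(modn_dvdm n (dvdn_gcdr u _)) nm modn_dvdm ?dvdn_gcdr.
apply: leq_trans (dvdn_leq _ L); last by rewrite subn_gt0.
rewrite -(leq_pmul2r m_gt0) -mulnA [(P * m)%N]mulnC -muln_lcm_gcd.
by rewrite leq_mul2l (dvdn_leq m_gt0 g_m) orbT.
Qed.

(** A union bound over [u]. For [u <= T] the count is at most [N / (u * P) + 1], with total rounding
    error at most [T]; for [u > T] the congruence is forgotten and the tail of [U] yields at most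
    [eps * N]. *)
Lemma cnt_multiples_eqmod (R : realType) (U : set nat) (c eps : R) (m P : nat) :
    (0 < m)%N -> (0 < P)%N -> recip_le U c -> 0 < eps ->
  exists C : R, forall N : nat,
    (cnt [set n | n = m %[mod m * P] /\ multiples U n] N)%:R
      <= (c / P%:R + eps) * N%:R + C.
Proof.
move=> m_gt0 P_gt0 Uc eps_gt0.
have [T /(_ _ (leqnn T)) UT] := recip_le_tail Uc eps_gt0.
exists T%:R => N.
pose F u := [set n | n = m %[mod m * P] /\ (u %| n)%N].
pose V := U `&` [set u | (T < u)%N].
have le_sum : (cnt [set n | n = m %[mod m * P] /\ multiples U n] N
    <= \sum_(1 <= u < N.+1 | `[< U u >]) cnt (F u) N)%N.
  rewrite [leqRHS]exchange_big /= /cnt !big_nat; apply: leq_sum => n /andP[n_gt0 nN].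
  case: asboolP => // -[nm [u Uu un]].
  rewrite big_mkcond (bigD1_seq u) ?iota_uniq ?mem_index_iota //=; last first.
    by rewrite (dvdn_gt0 n_gt0 un) (leq_ltn_trans (dvdn_leq n_gt0 un)).
  by rewrite (asboolT Uu) (asboolT (conj nm un)).
have cntT : (\sum_(1 <= u < N.+1) (u <= T) <= T)%N.
  elim: N {le_sum} => [|N IHN]; first by rewrite big_geq.
  rewrite big_nat_recr //=; case: (leqP N.+1 T) => [NT|_]; last by rewrite addn0.
  rewrite addn1; apply: leq_trans NT; rewrite ltnS.
  rewrite -[leqRHS]subn0 -subSS -[leqRHS]muln1 -sum_nat_const_nat.
  by apply: leq_sum => u _; exact: leq_b1.
have termE u : (0 < u)%N -> (cnt (F u) N)%:R
    <= N%:R / P%:R * u%:R^-1 + (u <= T)%:R + (if (T < u)%N then N%:R * u%:R^-1 else 0) :> R.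
  move=> u_gt0; have divR k : (0 < k)%N -> (N %/ k)%:R <= N%:R / k%:R :> R.
    by move=> k_gt0; rewrite ler_pdivlMr ?ltr0n // -natrM ler_nat leq_divM.
  have [uT|Tu] := leqP u T; last first.
    rewrite addr0; apply: (@le_trans _ _ (N %/ u)%:R); last first.
      by rewrite (le_trans (divR u u_gt0)) // lerDr !mulr_ge0 // invr_ge0.
    rewrite ler_nat divn_count_dvd.
    by apply: leq_sum => n _; case: asboolP => // -[_ ->].
  rewrite addr0 -mulrA -invfM -natrM mulnC.
  apply: (@le_trans _ _ ((N %/ (u * P)).+1)%:R); first by rewrite ler_nat cnt_dvdn_eqmod.
  by rewrite -natr1 lerD2r divR // muln_gt0 u_gt0.
rewrite -(ler_nat R) in le_sum; apply: (le_trans le_sum); rewrite natr_sum.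
apply: (@le_trans _ _ (\sum_(1 <= u < N.+1 | `[< U u >]) (N%:R / P%:R * u%:R^-1) +
   \sum_(1 <= u < N.+1) (u <= T)%:R + \sum_(1 <= u < N.+1 | `[< V u >]) (N%:R * u%:R^-1))).
  rewrite big_mkcond [X in _ <= X + _ + _]big_mkcond [X in _ <= _ + X]big_mkcond.
  rewrite -!big_split /= !big_nat; apply: ler_sum => u /andP[u_gt0 _].
  case: asboolP => [Uu|_]; last first.
    by rewrite add0r addr_ge0 //; case: ifP => // _; rewrite mulr_ge0 // invr_ge0.
  by rewrite (_ : `[< V u >] = (T < u)%N) ?termE //; apply/asboolP/idP => [[]|].
rewrite -!mulr_sumr -natr_sum.
have := Uc N; have := UT N; rewrite -/V; set x := bigop _ _ _; set y := bigop _ _ _ => xe yc.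
rewrite -(ler_nat R) in cntT.
rewrite mulrDl addrAC; apply: lerD => //; apply: lerD.
  by rewrite [leRHS]mulrAC [c * _]mulrC [leRHS]mulrAC ler_wpM2l // divr_ge0.
by rewrite [leRHS]mulrC ler_wpM2l.
Qed.

(** * Existence and positivity of the density *)

(** A condition on [gcdn n W] is [W]-periodic and so has a frequency; [A] differs from such a set
    only at multiples of [U], which are rare because the reciprocal sum of [U] is small. *)
Lemma gcd_approx_density (R : realType) (A : set nat) :
    (forall eps : R, 0 < eps -> exists W U, [/\ (0 < W)%N, recip_le U eps &
       forall n : nat, (0 < n)%N -> ~ multiples U n -> A n <-> A (gcdn n W)]) ->
  exists delta : R, forall eps : R, 0 < eps -> frequency_near A delta eps.
Proof.
move=> approx; apply: frequency_near_density => eps eps_gt0.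
have eps2_gt0 : 0 < eps / 2 by rewrite divr_gt0.
have [W [U [W_gt0 U_eps AW]]] := approx _ eps2_gt0.
pose B := [set n | A (gcdn n W)].
have BW n : (0 < n)%N -> B (W + n)%N <-> B n by rewrite /B /= gcdnC gcdnDl gcdnC.
(* With [m = P = 1] the congruence is void, so all multiples of [U] are counted. *)
have [C hC] := cnt_multiples_eqmod (ltnSn 0) (ltnSn 0) U_eps eps2_gt0.
exists ((cnt B W)%:R / W%:R), (C + W%:R) => N.
have := hC N; set E := [set n | _]; rewrite muln1 divr1 in E *.
have AB : (cnt A N)%:R <= (cnt B N)%:R + (cnt E N)%:R :> R.
  rewrite -natrD ler_nat cnt_leD // => n n_gt0 An.
  have [Un|nUn] := pselect (multiples U n); last by left; apply/(AW n).
  by right; split => //; rewrite !modn1.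
have BA : (cnt B N)%:R <= (cnt A N)%:R + (cnt E N)%:R :> R.
  rewrite -natrD ler_nat cnt_leD // => n n_gt0 Bn.
  have [Un|nUn] := pselect (multiples U n); last by left; apply/(AW n).
  by right; split => //; rewrite !modn1.
have := periodic_frequency R W_gt0 BW N.
set b := _ / _ * _; rewrite !ler_norml => /andP[? ?] ?; lra.
Qed.

(** The class of [m] modulo [m * P] has frequency at least [1 / (m * P)], and its multiples of [U]
    at most [c / P] up to a small error; the difference [eta] is positive because [c < 1 / m]. *)
Lemma eqmod_density_gt0 (R : realType) (A U : set nat) (m P : nat) (c delta : R) :
    (0 < m)%N -> (0 < P)%N ->
    (forall eps : R, 0 < eps -> frequency_near A delta eps) ->
    recip_le U c -> c < m%:R^-1 ->
    (forall n : nat, (0 < n)%N -> n = m %[mod m * P] -> ~ multiples U n -> A n) ->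
  0 < delta.
Proof.
move=> m_gt0 P_gt0 A_delta Uc c_lt AU; pose eta := (m%:R^-1 - c) / P%:R.
have mP_gt0 : (0 < m * P)%N by rewrite muln_gt0 m_gt0.
have eta_gt0 : 0 < eta by rewrite divr_gt0 ?subr_gt0 ?ltr0n.
have eps_gt0 : 0 < eta / 4 by rewrite divr_gt0.
have [C1 hC1] := A_delta _ eps_gt0.
have [C2 hC2] := cnt_multiples_eqmod m_gt0 P_gt0 Uc eps_gt0.
pose Q := [set n | n = m %[mod m * P]].
have QmP n : (0 < n)%N -> Q (m * P + n)%N <-> Q n by rewrite /Q /= modnDl.
have cntQ : (0 < cnt Q (m * P))%N.
  rewrite /cnt (bigD1_seq m) ?iota_uniq ?mem_index_iota //=; last first.
    by rewrite m_gt0 ltnS leq_pmulr.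
  by rewrite asboolT.
(* One error [eta / 4] comes from the frequency of [A], the other from the multiples of [U], so
   [delta] is at least [eta / 2]. *)
suff : eta - 2 * (eta / 4) - delta <= 0 by lra.
apply: (@archi_le0 _ _ (C1 + C2 + (m * P)%:R)) => N.
have QA : (cnt Q N)%:R <= (cnt A N)%:R +
    (cnt [set n | n = m %[mod m * P] /\ multiples U n] N)%:R :> R.
  rewrite -natrD ler_nat cnt_leD // => n n_gt0 Qn.
  by have [Un|nUn] := pselect (multiples U n); [right|left; exact: AU].
have := periodic_frequency R mP_gt0 QmP N.
have bQ : (m * P)%:R^-1 * N%:R <= (cnt Q (m * P))%:R / (m * P)%:R * N%:R :> R.
  by rewrite ler_wpM2r // ler_peMl ?invr_ge0 // ler1n.
have etaE : eta = (m * P)%:R^-1 - c / P%:R by rewrite /eta mulrBl natrM invfM.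
have := hC1 N; have := hC2 N; move: bQ; set b := _ / _ * N%:R.
rewrite !ler_norml => ? ? /andP[? ?] /andP[? ?].
have : eta * N%:R = (m * P)%:R^-1 * N%:R - c / P%:R * N%:R by rewrite etaE mulrBl.
lra.
Qed.

(** * The two implications *)

(** Take the least element of [supp f]: below it [f], hence also [g], vanishes, and the divisor sum
    reduces to its last term. The same [m] thus serves both implications. *)
Lemma exists_min_supp (V : zmodType) (f g : nat -> V)
    (fE : forall n : nat, (0 < n)%N -> f n = \sum_(d <- divisors n) g d) :
    ~ ((forall n : nat, (0 < n)%N -> f n = 0) /\
       (forall n : nat, (0 < n)%N -> g n = 0)) ->
  exists m : nat, [/\ (0 < m)%N, f m = g m & f m != 0].
Proof.
move=> fg_neq0.
have ex : exists m, (0 < m)%N && (f m != 0).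
  apply: contra_notP fg_neq0 => nex.
  have f0 n : (0 < n)%N -> f n = 0.
    by move=> n_gt0; apply/eqP; apply: contra_notT nex => fn; exists n; rewrite n_gt0.
  split=> // n n_gt0; apply: (divisor_sum_eq0 fE (n := n.+1)); last by rewrite n_gt0 /=.
  by move=> d /andP[d_gt0 _]; exact: f0.
have [m /andP[m_gt0 fm] m_min] := ex_minnP ex; exists m; split => //.
rewrite fE //; apply: sum_divisors_last => //; apply: (divisor_sum_eq0 fE) => d /andP[d_gt0 dm].
by apply/eqP; apply: contraTT dm => fd; rewrite -leqNgt m_min // d_gt0.
Qed.

Lemma positive_density_frequency (R : realType) (A : set nat) (delta : R) :
    0 < delta -> (forall eps : R, 0 < eps -> frequency_near A delta eps) ->
  has_positive_density R A.
Proof. by move=> delta_gt0 A_delta; exists delta => //; exact: has_density_frequency. Qed.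

Lemma divisor_sum_supp_density (R : realType) (V : zmodType) (f g : nat -> V)
    (fE : forall n : nat, (0 < n)%N -> f n = \sum_(d <- divisors n) g d) :
    ~ ((forall n : nat, (0 < n)%N -> f n = 0) /\
       (forall n : nat, (0 < n)%N -> g n = 0)) ->
  (reciprocal_sum R (supp g) < +oo)%E -> has_positive_density R (supp f).
Proof.
move=> fg_neq0 /reciprocal_sum_recip_le[c gc].
pose U T := supp g `&` [set u | (T < u)%N].
have gU T n : ~ multiples (U T) n ->
    forall d : nat, (T < d)%N -> g d <> 0 -> ~ (d %| n)%N.
  by move=> nUn d Td gd dn; apply: nUn; exists d => //; split=> //; split => //; case: (d) Td.
have [delta f_delta] : exists delta : R,
    forall eps : R, 0 < eps -> frequency_near (supp f) delta eps.
  apply: gcd_approx_density => eps eps_gt0.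
  have [T /(_ _ (leqnn T)) UT] := recip_le_tail gc eps_gt0.
  exists T`!, (U T); split => [||n n_gt0 /gU gT]; rewrite ?fact_gt0 //.
  rewrite /supp /= gcdn_gt0 n_gt0 -(divisor_sum_gcd fE n_gt0 gT).
  by split => -[].
have [m [m_gt0 fgm fm]] := exists_min_supp fE fg_neq0.
(* Any bound strictly below [1 / m] makes [eqmod_density_gt0] applicable. *)
have m2_gt0 : 0 < (2 * m)%:R^-1 :> R by rewrite invr_gt0 ltr0n muln_gt0.
have [T /(_ _ (leqnn T)) UT] := recip_le_tail gc m2_gt0.
apply: (positive_density_frequency _ f_delta).
apply: (eqmod_density_gt0 m_gt0 (fact_gt0 T) f_delta UT).
  by rewrite ltf_pV2 ?posrE ?ltr0n ?muln_gt0 ?m_gt0 // ltr_nat; lia.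
move=> n n_gt0 nm /gU gT; split => //.
by rewrite (divisor_sum_eqmod fE m_gt0 n_gt0 nm gT); exact/eqP.
Qed.

Lemma divisor_sum_inv_supp_density (R : realType) (V : zmodType) (f g : nat -> V)
    (fE : forall n : nat, (0 < n)%N -> f n = \sum_(d <- divisors n) g d) :
    ~ ((forall n : nat, (0 < n)%N -> f n = 0) /\
       (forall n : nat, (0 < n)%N -> g n = 0)) ->
  (reciprocal_sum R (supp f) < +oo)%E -> has_positive_density R (supp g).
Proof.
move=> fg_neq0 /reciprocal_sum_recip_le[c fc].
(* Used as [P T 0] for the squares of integers above [T], and as [P 1 k] for the powers of exponent
   [k + 2] of integers above 1. *)
pose P T k := [set u | exists2 q, (T < q)%N & u = (q ^ k.+2)%N].
pose U T := (supp f `&` [set u | (T < u)%N]) `|` P T 0%N.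
have fU T n : ~ multiples (U T) n ->
    forall d : nat, (T < d)%N -> f d <> 0 -> ~ (d %| n)%N.
  move=> nUn d Td fd dn; apply: nUn; exists d => //.
  by left; split=> //; split => //; case: (d) Td.
have sqU T n : ~ multiples (U T) n -> forall q : nat, (T < q)%N -> ~ (q ^ 2 %| n)%N.
  by move=> nUn q Tq qn; apply: nUn; exists (q ^ 2)%N => //; right; exists q.
have powk (eps : R) : 0 < eps ->
    exists t : nat, forall T, (t <= T)%N -> forall k, (0 < k)%N -> (k * T)%:R^-1 <= eps.
  move=> eps_gt0; exists (Num.truncn eps^-1).+1 => T tT k k_gt0.
  have T_gt0 : (0 < T)%N by exact: leq_trans tT.
  rewrite -[leRHS]invrK lef_pV2 ?posrE ?invr_gt0 ?ltr0n ?muln_gt0 ?k_gt0 //.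
  apply: le_trans (ltW (truncnS_gt _)) _; rewrite ler_nat.
  by rewrite (leq_trans tT) // leq_pmull.
have U_le (eps : R) : 0 < eps -> exists2 T, (0 < T)%N & recip_le (U T) (eps + eps).
  move=> eps_gt0; have [t ft] := recip_le_tail fc eps_gt0.
  have [s hs] := powk _ eps_gt0.
  exists (maxn t s).+1 => // N; apply: le_trans (recip_leU (ft _ _) (recip_le_pow _ _ _) N) _ => //.
    by rewrite (leq_trans (leq_maxl t s)).
  by rewrite lerD2l hs // (leq_trans (leq_maxr t s)).
have [delta g_delta] : exists delta : R,
    forall eps : R, 0 < eps -> frequency_near (supp g) delta eps.
  apply: gcd_approx_density => eps eps_gt0.
  (* Three shares: the tail of [supp f], the squares and the high powers. *)
  have eps3_gt0 : 0 < eps / 3 by rewrite divr_gt0.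
  have [T T_gt0 UT] := U_le _ eps3_gt0; have [k hk] := powk _ eps3_gt0.
  exists (T`! ^ k.+2)%N, (U T `|` P 1%N k).
  have sub n : ~ multiples (U T `|` P 1%N k) n -> ~ multiples (U T) n.
    by apply: contra_not => -[u Uu un]; exists u => //; left.
  split => [||n n_gt0 nUn]; first by rewrite expn_gt0 fact_gt0.
    move=> N; apply: le_trans (recip_leU UT (recip_le_pow _ _ (ltnSn 0)) N) _.
    have := hk k.+1 (leqnSn _) 1%N isT; rewrite mul1n muln1.
    by move: (_^-1) => x; clear; lra.
  rewrite /supp /= gcdn_gt0 n_gt0 /=.
  have := divisor_sum_inv_gcd fE (k := k.+1) n_gt0 (fU _ _ (sub _ nUn)) (sqU _ _ (sub _ nUn)).
  have powN q : (1 < q)%N -> ~ (q ^ k.+2 %| n)%N.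
    by move=> q_gt1 qn; apply: nUn; exists (q ^ k.+2)%N => //; right; exists q.
  move=> /(_ powN) gE.
  by split=> -[_ /eqP gn]; split=> //; apply/eqP; rewrite ?gE // -gE.
have [m [m_gt0 fgm fm]] := exists_min_supp fE fg_neq0.
(* The tail of [supp f] and the squares get [1 / (3 * m)] each, so their total stays below
   [1 / m]. *)
have m3_gt0 : 0 < (3 * m)%:R^-1 :> R by rewrite invr_gt0 ltr0n muln_gt0.
have [T T_gt0 UT] := U_le _ m3_gt0.
apply: (positive_density_frequency _ g_delta).
apply: (eqmod_density_gt0 m_gt0 (fact_gt0 T) g_delta UT).
  have : 0 < m%:R^-1 :> R by rewrite invr_gt0 ltr0n.
  by rewrite natrM invfM; lra.
move=> n n_gt0 nm nUn; split => //; apply/eqP.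
by rewrite (divisor_sum_inv_eqmod fE m_gt0 n_gt0 nm (fU _ _ nUn) (sqU _ _ nUn)) -fgm.
Qed.

Theorem theorem1p1 (R : realType) (f g : nat -> complex R)
    (fg_neq0 : ~ ((forall n : nat, (0 < n)%N -> f n = 0) /\
                  (forall n : nat, (0 < n)%N -> g n = 0)))
    (fE : forall n : nat, (0 < n)%N -> f n = \sum_(d <- divisors n) g d) :
  ((reciprocal_sum R (supp g) < +oo)%E -> has_positive_density R (supp f)) /\
  ((reciprocal_sum R (supp f) < +oo)%E -> has_positive_density R (supp g)).
Proof.
split; first exact: divisor_sum_supp_density fg_neq0.
exact: divisor_sum_inv_supp_density fg_neq0.
Qed.
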